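(* Suppose that $\mu$ is a Borel probability measure on $\mathbb R$ and $\nu$ is a Borel probability measure on $\mathbb R$ with finite first absolute moment. For $\pi\in\Pi(\mu,\nu)$ consider the objective $J(\pi)=\mathbb E[|Y-Y''|]$, where $(X,Y)$ and $(X,Y'')$ both have law $\pi$ and $Y,Y''$ are conditionally independent given $X$. Then the unique maximizer of $J$ over $\Pi(\mu,\nu)$ is the independent coupling $\pi_{\rm ind}=\mu\otimes\nu$. The set of minimizers of $J$ over $\Pi(\mu,\nu)$ is given by the set of Monge maps $\mathcal T(\mu,\nu)$.
   Context: $\Pi(\mu,\nu)$ is the set of all probability measures on $\mathbb R^2$ with marginals $\mu,\nu$. $\mathcal T(\mu,\nu)$ is the set of measurable maps $T:\mathbb R\to\mathbb R$ with $\mu\circ T^{-1}=\nu$; a map $T\in\mathcal T(\mu,\nu)$ is identified with the coupling in $\Pi(\mu,\nu)$ it induces, namely the law of $(X,T(X))$ with $X$ distributed as $\mu$.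
   Formalization: The description of the minimizers is proved when the set of Monge maps is nonempty; otherwise it fails, e.g. for μ = δ₀ and ν = (δ₀+δ₁)/2, where the only coupling is a minimizer but no Monge map exists. *)

(* Defs.v *)
(* MathComp-Analysis *)
From HB Require Import structures.
From mathcomp Require Import all_boot all_order all_algebra.
From mathcomp Require Import all_classical all_reals all_analysis.

Set Implicit Arguments.
Unset Strict Implicit.
Unset Printing Implicit Defensive.

Import Order.TTheory GRing.Theory Num.Theory.

Local Open Scope classical_set_scope.
Local Open Scope ring_scope.
Local Open Scope ereal_scope.

(* Equality of measures has to be tested on measurable sets only: a term of
   type [probability T R] is a function on all of [set T], and its values on
   non-measurable sets carry no meaning. *)
Definition eq_law d (T : measurableType d) (R : realType)
    (m1 m2 : set T -> \bar R) : Prop :=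
  forall A : set T, measurable A -> m1 A = m2 A.

Definition coupling (R : realType) (mu nu : probability R R) :
    set (probability (R * R)%type R) :=
  [set pi | eq_law (pushforward pi fst) mu /\ eq_law (pushforward pi snd) nu].

Definition monge_map (R : realType) (mu nu : probability R R) : set (R -> R) :=
  [set T | measurable_fun setT T /\ eq_law (pushforward mu T) nu].

Definition map_law (R : realType) (mu : probability R R) (T : R -> R) :
    set (R * R) -> \bar R :=
  pushforward mu (fun x => (x, T x)).

(* [g \o X] is a version of the conditional probability P(E | X). *)
Definition cond_prob_version d (Omega : measurableType d) (R : realType)
    (P : probability Omega R) (X : {RV P >-> R}) (E : set Omega)
    (g : R -> R) : Prop :=
  measurable_fun setT g /\
  forall A : set R, measurable A ->
    \int[P]_(w in X @^-1` A) (g (X w))%:E = P ((X @^-1` A) `&` E).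

(* P(Y \in B, Z \in C | X) = P(Y \in B | X) P(Z \in C | X) almost surely. *)
Definition cond_indep d (Omega : measurableType d) (R : realType)
    (P : probability Omega R) (X Y Z : {RV P >-> R}) : Prop :=
  forall B C : set R, measurable B -> measurable C ->
  exists g h : R -> R,
    [/\ cond_prob_version X (Y @^-1` B) g,
        cond_prob_version X (Z @^-1` C) h &
        cond_prob_version X ((Y @^-1` B) `&` (Z @^-1` C))
          (fun x => (g x * h x)%R)].

Definition joint_law d (Omega : measurableType d) (R : realType)
    (P : probability Omega R) (X Y : {RV P >-> R}) : set (R * R) -> \bar R :=
  pushforward P (fun w => (X w, Y w)).

Definition objective_value (R : realType) (pi : probability (R * R)%type R)
    (j : \bar R) : Prop :=
  exists (d : measure_display) (Omega : measurableType d)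
         (P : probability Omega R) (X Y Z : {RV P >-> R}),
    [/\ eq_law (joint_law X Y) pi,
        eq_law (joint_law X Z) pi,
        cond_indep X Y Z &
        j = 'E_P[fun w => `|Y w - Z w|%R]].

(* By disintegration, such a triple exists for every [pi] and its law is
   determined by [pi]; hence exactly one [j] satisfies [objective_value pi j],
   and the default value 0 of [xget] is never taken. *)
Definition objective (R : realType) (pi : probability (R * R)%type R) :
    \bar R :=
  xget 0 [set j | objective_value pi j].

Definition maximizer (R : realType) (mu nu : probability R R) :
    set (probability (R * R)%type R) :=
  [set pi | coupling mu nu pi /\
    forall pi', coupling mu nu pi' -> objective pi' <= objective pi].

Definition minimizer (R : realType) (mu nu : probability R R) :
    set (probability (R * R)%type R) :=
  [set pi | coupling mu nu pi /\
    forall pi', coupling mu nu pi' -> objective pi <= objective pi'].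

(* Main.v *)
Require Import Defs.
From HB Require Import structures.
From mathcomp Require Import all_boot all_order all_algebra.
From mathcomp Require Import all_classical all_reals all_analysis.
From mathcomp Require Import measurable_realfun ring lra.

Import Order.TTheory GRing.Theory Num.Theory.

Local Open Scope classical_set_scope.
Local Open Scope ring_scope.
Local Open Scope ereal_scope.

Set Implicit Arguments.
Unset Strict Implicit.

(** Let [pi] have marginals [mu] and [nu], and let [k_t(x)] be the conditional
    probability under [pi] that the second coordinate is at most [t], given
    that the first one is [x]. Writing [|y - z|] as the length of the set of
    [t] separating [y] from [z], conditional independence gives
    [J(pi) = 2 \int_t \int_x k_t (1 - k_t) dmu dt].
    With [F] the distribution function of [nu], the mean of [k_t] under [mu] is
    [F(t)], so the inner integral is [F(t) (1 - F(t)) - \int (k_t - F(t))^2 dmu]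
    ([spread_deviation]).

    Maximizers: for the product coupling [k_t] is the constant [F(t)] and the
    square term vanishes, whence [J(mu \x nu) = J(pi) + 2 \int_t \int_x
    (k_t - F(t))^2] ([objective_deviation]). The moment assumption makes [J]
    finite, so equality forces [k_t = F(t)] for almost every [t], hence for a
    dense set of [t], and this identifies [pi] ([eq_product_of_objective]).

    Minimizers: [J >= 0], and [J] vanishes on couplings given by a map. If
    conversely [J(pi) = 0], the two conditionally independent copies agree
    almost surely; freezing the randomness of the second one at a suitable
    value makes it a function of [X], which is then the required map
    ([monge_of_objective_eq0]).

    Both arguments need a concrete conditional law. It is obtained as a noise
    representation: a measurable [G] such that [(X, G (X, U))] has law [pi] for
    [U] uniform and independent of [X] ([exists_noise_representation]). It is
    the quantile transform of a family of conditional distribution functions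
    indexed by the rationals, themselves Radon-Nikodym densities. Then
    [(X, G (X, U), G (X, V))], with [V] a second independent noise, is a
    conditionally independent triple, and every other such triple has the same
    law of [(Y, Z)]; this is what makes the objective computable
    ([objectiveE]). *)

(** * Measures on the line and on products *)

(** The inequalities are only asked with a gap between [s] and [y]: this is what
    survives when the half-lines are only controlled at a dense set of
    endpoints. Continuity from below closes the gap, and open half-lines
    generate the Borel sets. *)
Lemma measure_eq_rays (R : realType) (m1 m2 : {finite_measure set R -> \bar R}) :
  (forall s y : R, (s < y)%R -> m1 `]-oo, s]%classic <= m2 `]-oo, y[%classic) ->
  (forall s y : R, (s < y)%R -> m2 `]-oo, s]%classic <= m1 `]-oo, y[%classic) ->
  forall B : set R, measurable B -> m1 B = m2 B.
Proof.
have ray (m m' : {finite_measure set R -> \bar R}) :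
    (forall s y : R, (s < y)%R -> m `]-oo, s]%classic <= m' `]-oo, y[%classic) ->
    forall y, m `]-oo, y[%classic <= m' `]-oo, y[%classic.
  move=> mm' y; pose F (n : nat) : set R := `]-oo, (y - n.+1%:R^-1)%R]%classic.
  have UF : \bigcup_n F n = `]-oo, y[%classic.
    apply/seteqP; split => [x [n _]|x]; rewrite /F /= !in_itv/=.
      by move=> /le_lt_trans; apply; rewrite ltrBlDr ltrDl invr_gt0.
    rewrite -subr_gt0 => /ltr_add_invr [n]; rewrite add0r => hn.
    by exists n => //; rewrite /= in_itv/= lerBrDl -lerBrDr ltW.
  have cF : (m \o F) n @[n --> \oo] --> m (\bigcup_n F n).
    apply: nondecreasing_cvg_mu => //.
    - by move=> n; exact: measurable_itv.
    - by apply: bigcupT_measurable => n; exact: measurable_itv.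
    - move=> i j ij; apply/subsetPset; apply: subset_itvl.
      by rewrite bnd_simp lerB// lef_pV2 ?posrE// ler_nat.
  rewrite -UF -(cvg_lim _ cF)//; apply: lime_le => //.
    by apply/cvg_ex; eexists; exact: cF.
  apply: nearW => n /=; rewrite UF; apply: mm'.
  by rewrite ltrBlDr ltrDl invr_gt0.
move=> h12 h21.
apply: (@measure_unique _ _ R [set `]-oo, x[%classic | x in [set: R]]
  (fun n => `]-oo, n%:R[%classic)).
- rewrite [LHS]RGenInftyO.measurableE; congr (<<s _ >>).
  apply/seteqP; split => [A [x ->]|A [x _ <-]]; by exists x.
- move=> _ _ [x _ <-] [y _ <-]; exists (Num.min x y) => //.
  apply/seteqP; split => [z|z]; rewrite /= !in_itv/= lt_min; first by move/andP.
  by move=> [-> ->].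
- by move=> n; exists n%:R.
- apply/seteqP; split => // x _.
  by exists (Num.truncn x).+1 => //=; rewrite in_itv/= truncnS_gt.
- by move=> _ [x _ <-]; apply/eqP; rewrite eq_le !ray.
- by move=> n; rewrite -ge0_fin_numE// fin_num_measure//; exact: measurable_itv.
Qed.

Lemma measure_eq_rectangles d1 d2 (T1 : measurableType d1)
    (T2 : measurableType d2) (R : realType)
    (m1 m2 : {finite_measure set (T1 * T2)%type -> \bar R}) :
  (forall A B, measurable A -> measurable B -> m1 (A `*` B) = m2 (A `*` B)) ->
  forall C : set (T1 * T2)%type, measurable C -> m1 C = m2 C.
Proof.
move=> m12.
apply: (@measure_unique _ _ _
  [set A `*` B | A in measurable & B in measurable] (fun=> setT)).
- exact: measurable_prod_measurableType.
- move=> _ _ [A mA [B mB <-]] [A' mA' [B' mB' <-]].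
  exists (A `&` A'); first exact: measurableI.
  by exists (B `&` B'); [exact: measurableI|rewrite setXI].
- by move=> _; exists setT => //; exists setT => //; rewrite setXTT.
- by rewrite bigcup_const.
- by move=> _ [A mA [B mB <-]]; exact: m12.
- by move=> _; rewrite -ge0_fin_numE// fin_num_measure.
Qed.

(** On the set where [g < f] the two functions have the same integral over every
    subset, so they agree there almost everywhere, a contradiction. *)
Lemma ae_le_integral_subsets d (T : measurableType d) (R : realType)
    (mu : {measure set T -> \bar R}) (f g : T -> \bar R) :
  mu.-integrable setT f -> mu.-integrable setT g ->
  (forall A, measurable A -> \int[mu]_(x in A) f x <= \int[mu]_(x in A) g x) ->
  {ae mu, forall x, f x <= g x}.
Proof.
move=> fi gi fg; have mf := measurable_int _ fi; have mg := measurable_int _ gi.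
pose D := [set x | g x < f x].
have mD : measurable D by rewrite -[D]setTI; exact: measurable_lte.
have : ae_eq mu D f g.
  apply: integral_ae_eq => //.
  - exact: (integrableS measurableT).
  - exact: measurable_funS mg.
  move=> E ED mE; apply/eqP; rewrite eq_le fg//=.
  apply: le_integral => //; [exact: (integrableS measurableT)..|].
  by move=> x /[!inE] /ED /ltW.
case=> N [mN N0 DN]; exists N; split => // x /= /negP; rewrite -ltNge => gfx.
by apply: DN => /= /(_ gfx) fgx; move: gfx; rewrite fgx ltxx.
Qed.

(** Every finite measure below that is obtained by fixing one side of a
    rectangle, or as the law of a random variable, is of this form. *)
Lemma exists_restricted_image d d' (T : measurableType d)
    (T' : measurableType d') (R : realType) (m : {finite_measure set T -> \bar R})
    (f : T -> T') (D : set T) :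
  measurable_fun setT f -> measurable D ->
  exists nu : {finite_measure set T' -> \bar R},
    forall A, nu A = m ((f @^-1` A) `&` D).
Proof.
move=> mf mD.
pose push_f : {measure set T' -> \bar R} := pushforward (mrestr m mD) f.
pose nu0 := push_f mf.
have nu0_fin : fin_num_fun nu0.
  move=> A mA; apply: fin_num_measure.
  by rewrite -[X in measurable X]setTI; exact: (mf measurableT).
pose nu : {finite_measure set T' -> \bar R} :=
  HB.pack (Measure.sort nu0) (Measure.class nu0)
    (Measure_isFinite.Build _ _ _ nu0 nu0_fin).
by exists nu.
Qed.

(** The domination [nu <= mu] bounds the Radon-Nikodym density by 1 almost
    everywhere, and truncating it makes the bound hold everywhere. *)
Lemma exists_density_le1 d (T : measurableType d) (R : realType)
    (mu nu : {finite_measure set T -> \bar R}) :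
  (forall A, measurable A -> nu A <= mu A) ->
  exists g : T -> R, [/\ measurable_fun setT g, forall x, (0 <= g x <= 1)%R &
    forall A, measurable A -> \int[mu]_(x in A) (g x)%:E = nu A].
Proof.
move=> numu.
have dom : nu `<< mu.
  apply/null_content_dominatesP => A mA muA0.
  by apply/eqP; rewrite eq_le measure_ge0 andbT -muA0 numu.
have [f [f0 ffin fi fE]] := radon_nikodym_sigma_finite dom.
have mf : measurable_fun setT (fine \o f).
  by apply: measurableT_comp => //; exact: measurable_int fi.
have f1 : {ae mu, forall x, f x <= 1}.
  apply: (ae_le_integral_subsets (g := cst 1)) => //.
    exact: (finite_measure_integrable_cst mu 1%R).
  move=> A mA; rewrite -fE// integral_cst//.
  by rewrite mul1e; exact: numu.
exists (fun x => Num.min (fine (f x)) 1)%R; split.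
- exact: measurable_minr.
- by move=> x; rewrite le_min fine_ge0//= ler01 ge_min lexx orbT.
move=> A mA; rewrite fE//; apply: ae_eq_integral => //.
- by apply/measurable_EFinP; apply: measurable_funTS; exact: measurable_minr.
- exact: measurable_funS (measurable_int _ fi).
case: f1 => N [mN N0 fN]; exists N; split => // x /= h; apply: fN => /= fx1.
apply: h => _; rewrite -[in RHS](fineK (ffin x)); congr EFin.
by apply/min_idPl; rewrite -lee_fin fineK.
Qed.

Lemma product_measure_sections d1 d2 (T1 : measurableType d1)
    (T2 : measurableType d2) (R : realType) (m1 : {measure set T1 -> \bar R})
    (m2 : {measure set T2 -> \bar R}) (A : set T1) (S : set (T1 * T2)%type) :
  (m1 \x m2) [set w | A w.1 /\ S w] = \int[m1]_(x in A) m2 [set y | S (x, y)].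
Proof.
rewrite /product_measure1 [RHS]integral_mkcond/=.
apply: eq_integral => x _ /=; rewrite patchE; case: ifPn => [|]; rewrite ?inE => Ax.
  by congr (m2 _); apply/seteqP; split => y; rewrite /xsection /= inE/=; tauto.
rewrite (_ : xsection _ _ = set0) ?measure0//; apply/seteqP; split => y //.
by rewrite /xsection /= inE/= => -[]; move: Ax; rewrite notin_setE.
Qed.

Lemma product_probability_fst d1 d2 (T1 : measurableType d1)
    (T2 : measurableType d2) (R : realType) (m1 : probability T1 R)
    (m2 : probability T2 R) (A : set T1) :
  measurable A -> (m1 \x m2) (fst @^-1` A) = m1 A.
Proof.
move=> mA; rewrite (_ : fst @^-1` A = A `*` setT).
  by rewrite product_measure1E// [X in _ * X](probability_setT m2) mule1.
by apply/seteqP; split => -[x y] //= [].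
Qed.

(** * Conditional distribution functions and noise representations *)

(** Each [F q] is the density of [A |-> pi (A `*` ]-oo, q])] with respect to
    [mu]. Monotonicity in [q] first holds off a null set for each of the
    countably many pairs of rationals; setting all densities to 0 on the union
    of these null sets makes it hold everywhere. *)
Lemma exists_conditional_cdf d (X : measurableType d) (R : realType)
    (mu : probability X R) (pi : probability (X * R)%type R) :
  (forall A, measurable A -> pi (A `*` setT) = mu A) ->
  exists F : rat -> X -> R,
    [/\ forall q, measurable_fun setT (F q),
        forall q x, (0 <= F q x <= 1)%R,
        forall q r x, (q <= r)%R -> (F q x <= F r x)%R &
        forall q A, measurable A ->
          \int[mu]_(x in A) (F q x)%:E = pi (A `*` `]-oo, ratr q]%classic)].
Proof.
move=> pi1.
have mX (A : set X) (y : R) : measurable A -> measurable (A `*` `]-oo, y]%classic).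
  by move=> mA; apply: measurableX.
have density q : exists g : X -> R, [/\ measurable_fun setT g,
    forall x, (0 <= g x <= 1)%R &
    forall A, measurable A ->
      \int[mu]_(x in A) (g x)%:E = pi (A `*` `]-oo, ratr q]%classic)].
  have [nu nuE] := exists_restricted_image pi measurable_fst
    (mX setT (ratr q) measurableT).
  have {}nuE A : nu A = pi (A `*` `]-oo, ratr q]%classic).
    by rewrite nuE; congr (pi _); apply/seteqP; split => -[x y] /=; tauto.
  have [g [mg g01 gE]] : exists g : X -> R, [/\ measurable_fun setT g,
      forall x, (0 <= g x <= 1)%R &
      forall A, measurable A -> \int[mu]_(x in A) (g x)%:E = nu A].
    apply: exists_density_le1 => A mA; rewrite nuE -[leRHS]pi1//.
    apply: le_measure; rewrite ?inE; [exact: mX|exact: measurableX|].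
    by move=> [x y] [].
  by exists g; split => // A mA; rewrite gE// nuE.
have [F0 F0P] := choice density.
have mF0 q : measurable_fun setT (F0 q) by case: (F0P q).
have F0_01 q x : (0 <= F0 q x <= 1)%R by case: (F0P q).
have F0E q A : measurable A ->
    \int[mu]_(x in A) (F0 q x)%:E = pi (A `*` `]-oo, ratr q]%classic).
  by case: (F0P q) => _ _; exact.
have iF0 q : mu.-integrable setT (EFin \o F0 q).
  apply: measurable_bounded_integrable => //.
    by rewrite (le_lt_trans (probability_le1 _ _)) ?ltry.
  exists 1%R; split => // M M1 x _ /=.
  by case/andP: (F0_01 q x) => h0 h1; rewrite ger0_norm// (le_trans h1)// ltW.
have F0le (q r : rat) : (q <= r)%R -> {ae mu, forall x, (F0 q x <= F0 r x)%R}.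
  move=> qr.
  have [|N [mN N0 FN]] := @ae_le_integral_subsets _ _ _ mu _ _ (iF0 q) (iF0 r).
    move=> A mA; rewrite !F0E//; apply: le_measure; rewrite ?inE; [exact: mX..|].
    move=> [x y] /= [Ax]; rewrite !in_itv/= => yq; split => //.
    by apply: (le_trans yq); rewrite ler_rat.
  by exists N; split => // x /= h; apply: FN => /=; rewrite lee_fin.
have /ae_foralln [N [mN N0 FN]] : forall n : nat, {ae mu, forall x,
    if unpickle n : option (rat * rat) is Some (q, r) then
      (q <= r)%R -> (F0 q x <= F0 r x)%R
    else True}.
  move=> n; case: (unpickle n) => [[q r]|]; last exact: aeW.
  have [qr|qr] := boolP (q <= r)%R; last exact: aeW.
  by have [N [mN N0 FN]] := F0le _ _ qr; exists N; split => // x /= h;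
    apply: FN => /= h'; apply: h.
(* [N] contains every point where some inequality between densities fails. *)
exists (fun q x => F0 q x * \1_(~` N) x)%R; split.
- move=> q; apply: measurable_funM => //; apply: measurable_indic.
  exact: measurableC.
- move=> q x; rewrite indicE; case: (_ \in _); rewrite ?mulr1// mulr0.
  by rewrite lexx ler01.
- move=> q r x qr; rewrite indicE; have [|_] := boolP (_ \in _); last first.
    by rewrite !mulr0.
  rewrite inE !mulr1 => /= Nx; apply: contrapT => h; apply: Nx; apply: FN => /=.
  by move=> /(_ (pickle (q, r))); rewrite pickleK => /(_ qr).
move=> q A mA; rewrite -F0E//; apply: ae_eq_integral => //.
- apply/measurable_EFinP; apply: measurable_funTS; apply: measurable_funM => //.
  by apply: measurable_indic; exact: measurableC.
- by apply/measurable_EFinP; exact: measurable_funTS.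
exists N; split => // x /= h; apply: contrapT => Nx; apply: h => _.
by rewrite indicE mem_set// mulr1.
Qed.

Definition uniform01 (R : realType) : probability (measurableTypeR R) R :=
  uniform_prob (@ltr01 R).

Lemma uniform01_le (R : realType) (c : R) :
  (0 <= c <= 1)%R -> uniform01 R [set u | (u <= c)%R] = c%:E.
Proof.
move=> /andP[c0 c1]; rewrite /uniform01 /= /uniform_prob integral_uniform_pdf.
have -> : [set u : R | (u <= c)%R] `&` `[0%R, 1%R] = `[0%R, c]%classic.
  apply/seteqP; split => x; rewrite /= !in_itv/=; first by move=> [-> /andP[->]].
  by move=> /andP[-> xc]; split => //=; exact: le_trans c1.
rewrite (eq_integral (cst 1)); last first.
  move=> x; rewrite inE /= in_itv/= /uniform_pdf => /andP[-> xc].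
  by rewrite (le_trans xc c1) subr0 invr1.
rewrite integral_cst//= mul1e lebesgue_measure_itv/= lte_fin.
by have [_|] := ltP 0%R c; rewrite ?sube0// => c0'; congr EFin; apply/le_anti/andP.
Qed.

Lemma product_measure_subgraph d (X : measurableType d) (R : realType)
    (mu : probability X R) (f : X -> R) (A : set X) :
  measurable_fun setT f -> (forall x, (0 <= f x <= 1)%R) -> measurable A ->
  (mu \x uniform01 R) [set w | A w.1 /\ (w.2 <= f w.1)%R] =
  \int[mu]_(x in A) (f x)%:E.
Proof.
move=> mf f01 mA; transitivity (\int[mu]_(x in A)
    uniform01 R [set u | (u <= f x)%R]); last first.
  by apply: eq_integral => x _; rewrite uniform01_le.
exact: (@product_measure_sections _ _ _ _ _ mu (uniform01 R) A
  (fun w => is_true (w.2 <= f w.1)%R)).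
Qed.

Definition noise_represents d (X : measurableType d) (R : realType)
    (mu : probability X R) (pi : probability (X * R)%type R)
    (G : X * measurableTypeR R -> R) : Prop :=
  measurable_fun setT G /\
  forall A B, measurable A -> measurable B ->
    (mu \x uniform01 R) [set w | A w.1 /\ B (G w)] = pi (A `*` B).

(** Inverse transform sampling: [G] is the finite part of
    [V (x, u) = inf {q | u <= F q x}]. The event [V < y] is the countable union
    over [q < y] of the subgraphs [E q] of [F q], and the product measure of
    [A `*` setT] intersected with [E q] is [pi (A `*` ]-oo, q])]. The limits of [F]
    at infinity are only right off a null set: the events [V = -oo] and
    [V = +oo] are null because the half-lines exhaust the mass of [pi]. *)
Lemma exists_noise_representation d (X : measurableType d) (R : realType)
    (mu : probability X R) (pi : probability (X * R)%type R) :
  (forall A, measurable A -> pi (A `*` setT) = mu A) ->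
  exists G : X * measurableTypeR R -> R, noise_represents mu pi G.
Proof.
move=> pi1; have [F [mF F01 Fmono FE]] := exists_conditional_cdf pi1.
pose P : probability _ R := (mu \x uniform01 R).
pose E q : set (X * measurableTypeR R) := [set w | (w.2 <= F q w.1)%R].
have mE q : measurable (E q).
  rewrite -[E q]setTI; apply: measurable_fun_le => //.
  exact: measurableT_comp.
have PE q A : measurable A ->
    P [set w | A w.1 /\ E q w] = pi (A `*` `]-oo, ratr q]%classic).
  by move=> mA; rewrite -FE//; exact: product_measure_subgraph.
have PET q : P (E q) = pi (setT `*` `]-oo, ratr q]%classic).
  by rewrite -(PE q _ measurableT); congr (P _); apply/seteqP; split => w //= [].
have E_mono q r : (q <= r)%R -> E q `<=` E r.
  by move=> qr w; rewrite /E /= => /le_trans; apply; exact: Fmono.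
pose V w : \bar R := ereal_inf [set (ratr q)%:E | q in [set q | E q w]].
have V_le q w : E q w -> V w <= (ratr q)%:E.
  by move=> Eqw; apply: ereal_inf_lbound; exists q.
have V_lt y w : V w < y -> exists2 q, E q w & (ratr q)%:E < y.
  by move=> /ereal_inf_lt [_ [q Eqw <-] qy]; exists q.
have mV : measurable_fun setT V.
  apply: (measurability _ (ErealGenInftyO.measurableE R)) => _ [_ [y ->] <-].
  rewrite setTI [X in measurable X](_ : _ =
      \bigcup_q (if (ratr q < y)%R then E q else set0)).
    by apply: bigcupT_measurable_rat => q; case: ifP.
  apply/seteqP; split => w; rewrite /= ?in_itv/=.
    by move=> /V_lt [q Eqw]; rewrite lte_fin => qy; exists q => //; rewrite qy.
  move=> [q _]; case: ifP => // qy Eqw.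
  by apply: (le_lt_trans (V_le _ _ Eqw)); rewrite lte_fin.
(* On [V = -oo] the point lies in every [E (- n)], and these have measures
   [pi (setT `*` ]-oo, - n])] tending to 0. *)
have VNy0 : P [set w | V w = -oo] = 0.
  pose N (n : nat) := E (- n%:R)%R.
  have cN : (P \o N) n @[n --> \oo] --> P (\bigcap_n N n).
    apply: nonincreasing_cvg_mu => //.
    - by rewrite (le_lt_trans (probability_le1 _ _)) ?ltry//; exact: mE.
    - by move=> n; exact: mE.
    - by apply: bigcapT_measurable => n; exact: mE.
    - move=> m n mn; apply/subsetPset; apply: E_mono.
      by rewrite lerN2 ler_nat.
  have cpi : (P \o N) n @[n --> \oo] --> (0 : \bar R).
    rewrite (_ : P \o N = pi \o (fun n =>
      [set: X] `*` `]-oo, (- n%:R)%R : R]%classic)); last first.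
      apply/funext => n /=; rewrite PET; congr (pi (_ `*` _)).
      by rewrite rmorphN/= ratr_nat.
    rewrite -(measure0 pi) -(_ : \bigcap_n
      ([set: X] `*` `]-oo, (- n%:R)%R : R]%classic) = set0); last first.
      rewrite -subset0 => -[x y] /(_ (Num.truncn (- y)%R).+1 I) [_] /=.
      by rewrite in_itv/= leNgt => /negP; apply; rewrite ltrNl truncnS_gt.
    apply: nonincreasing_cvg_mu => //.
    - by rewrite (le_lt_trans (probability_le1 _ _)) ?ltry//; exact: measurableX.
    - by move=> n; exact: measurableX.
    - by apply: bigcapT_measurable => n; exact: measurableX.
    - move=> m n mn; apply/subsetPset => -[x y] /= [_]; rewrite !in_itv/=.
      by move=> /le_trans yn; split => //; apply: yn; rewrite lerN2 ler_nat.
  apply/eqP; rewrite eq_le measure_ge0 andbT.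
  have <- : P (\bigcap_n N n) = 0 by exact: cvg_unique cN cpi.
  apply: le_measure; rewrite ?inE.
  - by rewrite -[X in measurable X]setTI; exact: (mV measurableT [set -oo]).
  - by apply: bigcapT_measurable => n; exact: mE.
  - move=> w /= Vw n _; have : V w < (- n%:R)%:E by rewrite Vw ltNyr.
    move=> /V_lt [q Eqw qn]; apply: E_mono Eqw.
    by move: qn; rewrite lte_fin -(ratr_nat R) -rmorphN/= ltr_rat => /ltW.
(* On [V = +oo] the point lies in no [E n], and these exhaust the mass. *)
have Vy0 : P [set w | V w = +oo] = 0.
  pose N (n : nat) := E n%:R.
  have mUN : measurable (\bigcup_n N n).
    by apply: bigcupT_measurable => n; exact: mE.
  have cN : (P \o N) n @[n --> \oo] --> P (\bigcup_n N n).
    apply: nondecreasing_cvg_mu => //.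
    - by move=> n; exact: mE.
    - move=> m n mn; apply/subsetPset; apply: E_mono.
      by rewrite ler_nat.
  have cpi : (P \o N) n @[n --> \oo] --> (1 : \bar R).
    rewrite (_ : P \o N = pi \o (fun n =>
      [set: X] `*` `]-oo, n%:R : R]%classic)); last first.
      by apply/funext => n /=; rewrite PET ratr_nat.
    rewrite -(probability_setT pi) -(_ : \bigcup_n
      ([set: X] `*` `]-oo, n%:R : R]%classic) = setT); last first.
      rewrite -subTset => -[x y] _; exists (Num.truncn y).+1 => //; split => //.
      by rewrite /= in_itv/= ltW// truncnS_gt.
    apply: nondecreasing_cvg_mu => //.
    - by move=> n; exact: measurableX.
    - by apply: bigcupT_measurable => n; exact: measurableX.
    - move=> m n mn; apply/subsetPset => -[x y] /= [_]; rewrite !in_itv/=.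
      by move=> ym; split => //; apply: (le_trans ym); rewrite ler_nat.
  have PN1 : P (\bigcup_n N n) = 1 by exact: cvg_unique cN cpi.
  have PN0 : P (~` (\bigcup_n N n)) = 0.
    by rewrite probability_setC// PN1 subee.
  apply/eqP; rewrite eq_le measure_ge0 andbT -PN0.
  apply: le_measure; rewrite ?inE.
  - by rewrite -[X in measurable X]setTI; exact: (mV measurableT [set +oo]).
  - exact: measurableC.
  - by move=> w /= Vw [n _ /V_le]; rewrite Vw leye_eq.
pose G w := fine (V w).
have mG : measurable_fun setT G by exact: measurableT_comp mV.
exists G; split => // A B mA mB.
have mA1 : measurable (A `*` [set: measurableTypeR R]) by exact: measurableX.
have mA2 : measurable (A `*` [set: R]) by exact: measurableX.
have [nu1 nu1E] := exists_restricted_image P mG mA1.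
have [nu2 nu2E] := exists_restricted_image pi measurable_snd mA2.
have nu2R y : nu2 `]-oo, y]%classic = pi (A `*` `]-oo, y]%classic).
  by rewrite nu2E; congr (pi _); apply/seteqP; split => -[x z] /=; tauto.
transitivity (nu1 B).
  by rewrite nu1E; congr (P _); apply/seteqP; split => -[x u] /=; tauto.
transitivity (nu2 B); last first.
  by rewrite nu2E; congr (pi _); apply/seteqP; split => -[x z] /=; tauto.
have mAE q : measurable [set w | A w.1 /\ E q w].
  rewrite (_ : mkset _ = (A `*` setT) `&` E q); first exact: measurableI.
  by apply/seteqP; split => -[x u] /=; tauto.
have mVset D : measurable D -> measurable (V @^-1` D).
  by move=> mD; rewrite -[X in measurable X]setTI; exact: mV.
have mGset D : measurable D -> measurable (G @^-1` D).
  by move=> mD; rewrite -[X in measurable X]setTI; exact: mG.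
have padd (C D : set (X * measurableTypeR R)) : measurable C -> measurable D ->
    P D = 0 -> P (C `|` D) <= P C.
  move=> mC mD PD; apply: (le_trans (measureU2 P mC mD)).
  by rewrite [X in _ + X]PD adde0.
(* A rational [q] strictly between [s] and [y] separates both half-lines:
   [G <= s] forces [E q] and [E q] forces [G < y], up to the null events. *)
apply: measure_eq_rays => // s y /rat_in_itvoo [q]; rewrite in_itv/= => /andP[sq qy].
- apply: (@le_trans _ _ (nu2 `]-oo, ratr q]%classic)); last first.
    by apply: le_measure; rewrite ?inE//; apply: subset_itvl; rewrite bnd_simp.
  rewrite nu2R -PE// nu1E.
  apply: le_trans (padd _ [set w | V w = +oo] (mAE q) _ Vy0); last first.
    exact: (mVset [set +oo]).
  apply: le_measure; rewrite ?inE.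
  + by apply: measurableI => //; exact: mGset.
  + by apply: measurableU => //; exact: (mVset [set +oo]).
  move=> w [] /=; rewrite in_itv/= /G => Gs [Aw _].
  have [Vy|Vy] := eqVneq (V w) +oo; [by right|left; split => //].
  have : V w < (ratr q)%:E.
    by case: (V w) Gs Vy => //= [r rs _|_ _]; rewrite ?ltNyr// lte_fin (le_lt_trans rs).
  move=> /V_lt [q' Eq'w q'q]; apply: E_mono Eq'w.
  by move: q'q; rewrite lte_fin ltr_rat => /ltW.
- apply: (@le_trans _ _ (nu2 `]-oo, ratr q]%classic)).
    by apply: le_measure; rewrite ?inE//; apply: subset_itvl; rewrite bnd_simp ltW.
  rewrite nu2R -PE// nu1E.
  apply: le_trans (padd _ [set w | V w = -oo] _ _ VNy0); last 2 first.
  + by apply: measurableI => //; exact: mGset.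
  + exact: (mVset [set -oo]).
  apply: le_measure; rewrite ?inE => //.
  + apply: measurableU; last exact: (mVset [set -oo]).
    by apply: measurableI => //; exact: mGset.
  move=> w /= [Aw /V_le Vq]; rewrite /G in_itv/=.
  case: (V w) Vq => [r||]; [|by rewrite leye_eq|by right].
  by rewrite lee_fin => rq; left; split => //=; exact: le_lt_trans qy.
Qed.

Opaque uniform01.

(** * The conditional law given by a noise representation *)

(** A version of a conditional probability is only known to be measurable, so
    [f] ranges over all measurable functions; its positive and negative parts
    are transported separately. *)
Lemma integral_image_law d d' (T : measurableType d) (T' : measurableType d')
    (R : realType) (P : {measure set T -> \bar R}) (m : {measure set T' -> \bar R})
    (phi : T -> T') (A : set T') (f : T' -> \bar R) :
  measurable_fun setT phi ->
  (forall B, measurable B -> P (phi @^-1` B) = m B) ->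
  measurable A -> measurable_fun A f ->
  \int[P]_(w in phi @^-1` A) f (phi w) = \int[m]_(x in A) f x.
Proof.
move=> mphi Pm mA mf.
have ge0 (g : T' -> \bar R) : measurable_fun A g -> (forall x, 0 <= g x) ->
    \int[P]_(w in phi @^-1` A) g (phi w) = \int[m]_(x in A) g x.
  move=> mg g0.
  transitivity (\int[pushforward P phi]_(x in A) g x).
    by rewrite ge0_integral_pushforward.
  by apply: eq_measure_integral => // B mB _; exact: Pm.
rewrite integralE [RHS]integralE; congr (_ - _).
- rewrite -(ge0 (funepos f))//; last exact: measurable_funepos.
  by apply: eq_integral => w _; rewrite !funeposE.
- rewrite -(ge0 (funeneg f))//; last exact: measurable_funeneg.
  by apply: eq_integral => w _; rewrite !funenegE.
Qed.

(** A regular version of the conditional probability, under [pi], of [B] for the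
    second coordinate given the first: a probability measure in [B] for every
    [x]. *)
Definition noise_kernel d (X : measurableType d) (R : realType)
    (G : X * measurableTypeR R -> R) (B : set R) (x : X) : R :=
  fine (uniform01 R [set u | B (G (x, u))]).

Section noise_kernel.
Context d (X : measurableType d) (R : realType).
Variables (mu : probability X R) (pi : probability (X * R)%type R).
Variable G : X * measurableTypeR R -> R.
Hypothesis GP : noise_represents mu pi G.
Local Notation kG := (noise_kernel G).

Lemma measurable_noise_section (B : set R) (x : X) : measurable B ->
  measurable [set u | B (G (x, u))].
Proof.
move=> mB; rewrite -[X in measurable X]setTI.
exact: (measurableT_comp GP.1 (measurable_pair1 x)).
Qed.

Lemma noise_kernelE (B : set R) (x : X) : measurable B ->
  (kG B x)%:E = uniform01 R [set u | B (G (x, u))].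
Proof.
by move=> mB; rewrite fineK// fin_num_measure//; exact: measurable_noise_section.
Qed.

Lemma noise_kernel01 (B : set R) (x : X) : measurable B -> (0 <= kG B x <= 1)%R.
Proof.
move=> mB; rewrite -!lee_fin noise_kernelE// measure_ge0/=.
by apply: probability_le1; exact: measurable_noise_section.
Qed.

Lemma noise_kernelC (B : set R) (x : X) : measurable B ->
  kG (~` B) x = (1 - kG B x)%R.
Proof.
move=> mB; apply: EFin_inj; rewrite EFinB !noise_kernelE//; last exact: measurableC.
by rewrite -probability_setC//; exact: measurable_noise_section.
Qed.

Let measurable_repr (B : set R) : measurable B -> measurable (G @^-1` B).
Proof. by move=> mB; rewrite -[X in measurable X]setTI; exact: GP.1. Qed.

Lemma measurable_noise_kernel (B : set R) : measurable B ->
  measurable_fun setT (kG B).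
Proof.
move=> mB; apply: measurableT_comp => //.
rewrite (_ : (fun x => _) = uniform01 R \o xsection (G @^-1` B)).
  by apply: measurable_fun_xsection; exact: measurable_repr.
apply/funext => x /=; congr (uniform_prob _); apply/seteqP.
by split => u; rewrite /xsection /= inE.
Qed.

Lemma integrable_noise_kernel (B : set R) : measurable B ->
  mu.-integrable setT (EFin \o kG B).
Proof.
move=> mB; apply: measurable_bounded_integrable => //.
- by rewrite (le_lt_trans (probability_le1 _ _)) ?ltry.
- exact: measurable_noise_kernel.
exists 1%R; split => // M M1 x _ /=.
case/andP: (noise_kernel01 x mB) => h0 h1.
by rewrite ger0_norm// (le_trans h1)// ltW.
Qed.

Lemma integral_noise_kernel (A : set X) (B : set R) :
  measurable A -> measurable B ->
  \int[mu]_(x in A) (kG B x)%:E = pi (A `*` B).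
Proof.
move=> mA mB; rewrite -GP.2// -[RHS]/((mu \x uniform01 R)
  [set w | A w.1 /\ (G @^-1` B) w]) product_measure_sections.
by apply: eq_integral => x _; rewrite noise_kernelE.
Qed.

(** Any version of the conditional probability agrees with the kernel, both being
    densities of [A |-> pi (A `*` B)] with respect to [mu]. *)
Lemma noise_kernel_unique (B : set R) (g : X -> R) :
  measurable B -> measurable_fun setT g ->
  (forall A, measurable A -> \int[mu]_(x in A) (g x)%:E = pi (A `*` B)) ->
  {ae mu, forall x, kG B x = g x}.
Proof.
move=> mB mg gE.
have [] := @integral_ae_eq _ _ _ mu setT measurableT (EFin \o g) (EFin \o kG B).
- exact: integrable_noise_kernel.
- exact/measurable_EFinP.
- by move=> E _ mE; rewrite gE// integral_noise_kernel.
move=> N [mN N0 kN]; exists N; split => // x /= h; apply: kN => /= h'.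
by apply: h; have [] := h' I.
Qed.

End noise_kernel.

(** * The objective as an integral over two independent noises *)

Section cond_indep_law.
Context (R : realType).
Variables (mu : probability R R) (pi : probability (R * R)%type R).
Variable G : R * measurableTypeR R -> R.
Hypothesis GP : noise_represents mu pi G.
Local Notation kG := (noise_kernel G).

Lemma first_marginal (A : set R) : measurable A -> pi (A `*` setT) = mu A.
Proof.
move=> mA; rewrite -GP.2//.
transitivity ((mu \x uniform01 R) (fst @^-1` A)).
  by congr (product_measure1 _ _ _); apply/seteqP; split => w //= [].
exact: product_probability_fst.
Qed.

Section triple.
Context d (Omega : measurableType d) (P : probability Omega R).
Variables X Y Z : {RV P >-> R}.
Hypothesis XY : eq_law (joint_law X Y) pi.
Hypothesis XZ : eq_law (joint_law X Z) pi.

Let X_law (A : set R) : measurable A -> P (X @^-1` A) = mu A.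
Proof.
move=> mA; rewrite -first_marginal// -XY; last exact: measurableX.
by rewrite /joint_law /pushforward; congr (P _); apply/seteqP; split => w /=; tauto.
Qed.

Let cond_prob_kernel (W : {RV P >-> R}) (B : set R) (g : R -> R) :
  eq_law (joint_law X W) pi -> measurable B ->
  cond_prob_version X (W @^-1` B) g -> {ae mu, forall x, kG B x = g x}.
Proof.
move=> XW mB [mg gE]; apply: (noise_kernel_unique GP) => // A mA.
rewrite -(integral_image_law (f := EFin \o g) _ X_law)//; last first.
  by apply/measurable_EFinP; exact: measurable_funTS.
rewrite gE// -XW; last exact: measurableX.
by rewrite /joint_law /pushforward; congr (P _); apply/seteqP; split => w /=; tauto.
Qed.

(** Whatever the probability space, versions of the conditional probabilities of
    [Y] and [Z] coincide [mu]-almost everywhere with the kernel of [G], so the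
    law of [(Y, Z)] is determined by [pi] on rectangles. *)
Lemma cond_indep_rectangle (B C : set R) : cond_indep X Y Z ->
  measurable B -> measurable C ->
  P ((Y @^-1` B) `&` (Z @^-1` C)) = \int[mu]_x (kG B x * kG C x)%:E.
Proof.
move=> YZ mB mC; have [g [h [gP hP [mgh ghE]]]] := YZ B C mB mC.
have kg := cond_prob_kernel XY mB gP.
have kh := cond_prob_kernel XZ mC hP.
have := ghE setT measurableT; rewrite preimage_setT setTI => <-.
rewrite -(preimage_setT X) (integral_image_law
  (f := fun x => (g x * h x)%:E) _ X_law)//; last exact/measurable_EFinP.
apply: ae_eq_integral => //.
- exact/measurable_EFinP.
- by apply/measurable_EFinP; apply: measurable_funM;
    exact: (measurable_noise_kernel GP).
by apply: filterS2 kg kh => x -> -> _.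
Qed.

End triple.

(** Two triples realizing [pi] give [(Y, Z)] the same law on rectangles, hence on
    all measurable sets of the plane, and the expectation of [|Y - Z|] only
    depends on that law. *)
Lemma objective_value_unique (j j' : \bar R) :
  objective_value pi j -> objective_value pi j' -> j = j'.
Proof.
move=> [d [W [P [X [Y [Z [XY XZ YZ ->]]]]]]].
move=> [d' [W' [P' [X' [Y' [Z' [XY' XZ' YZ' ->]]]]]]].
have mYZ : measurable_fun setT (fun w => (Y w, Z w)) by exact/measurable_fun_prod.
have mYZ' : measurable_fun setT (fun w => (Y' w, Z' w)).
  exact/measurable_fun_prod.
have [m mE] := exists_restricted_image P mYZ measurableT.
have [m' m'E] := exists_restricted_image P' mYZ' measurableT.
have mm' : forall A, measurable A -> m A = m' A.
  apply: measure_eq_rectangles => B C mB mC; rewrite mE m'E !setIT.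
  have := cond_indep_rectangle XY XZ YZ mB mC.
  have := cond_indep_rectangle XY' XZ' YZ' mB mC.
  by move=> <-; exact.
have mdist : measurable_fun setT (fun y : R * R => (`|y.1 - y.2|%R)%:E).
  by apply/measurable_EFinP; apply: measurableT_comp => //; exact: measurable_funB.
rewrite unlock.
transitivity (\int[m]_y (`|y.1 - y.2|%R)%:E).
  rewrite -(integral_image_law (P := P) (phi := fun w => (Y w, Z w)))//.
  by move=> B mB; have /esym := mE B; rewrite setIT; exact.
rewrite (eq_measure_integral m')//; last by move=> A mA _; exact: mm'.
rewrite -(integral_image_law (P := P') (phi := fun w => (Y' w, Z' w)))//.
by move=> B mB; have /esym := m'E B; rewrite setIT; exact.
Qed.

(** * The canonical conditionally independent copies *)

Definition noise_space : probability (R * measurableTypeR R)%type R :=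
  mu \x uniform01 R.
Definition copies_space :
    probability (R * measurableTypeR R * measurableTypeR R)%type R :=
  noise_space \x uniform01 R.
Local Notation P1 := noise_space.
Local Notation P2 := copies_space.

Let G2 (w : R * measurableTypeR R * measurableTypeR R) : R := G (w.1.1, w.2).

Let mG2 : measurable_fun setT G2.
Proof.
apply: (measurableT_comp GP.1); apply/measurable_fun_prod => //=.
exact: measurableT_comp.
Qed.

Let second_copyE (D : set (R * measurableTypeR R)) (C : set R) :
  measurable D -> measurable C ->
  P2 [set w | D w.1 /\ C (G2 w)] = \int[P1]_(w in D) (kG C w.1)%:E.
Proof.
move=> mD mC; rewrite -[LHS]/((P1 \x uniform01 R)
  [set w | D w.1 /\ (G2 @^-1` C) w]) product_measure_sections.
by apply: eq_integral => w _; rewrite (noise_kernelE GP).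
Qed.

Lemma noise_space_fst (A : set R) : measurable A -> P1 (fst @^-1` A) = mu A.
Proof. exact: product_probability_fst. Qed.

Let P2_fst (D : set (R * measurableTypeR R)) : measurable D ->
  P2 (fst @^-1` D) = P1 D.
Proof. exact: product_probability_fst. Qed.

Let mAG (A B : set R) : measurable A -> measurable B ->
  measurable [set w : R * measurableTypeR R | A w.1 /\ B (G w)].
Proof.
move=> mA mB; apply: measurableI.
  by rewrite -[X in measurable X]setTI; exact: measurable_fst.
by rewrite -[X in measurable X]setTI; exact: GP.1.
Qed.

Let integral_first_copy (A B : set R) (f : R -> R) :
  measurable A -> measurable B -> measurable_fun setT f ->
  (forall x, (0 <= f x)%R) ->
  \int[P1]_(w in [set w | A w.1 /\ B (G w)]) (f w.1)%:E =
  \int[mu]_(x in A) (kG B x * f x)%:E.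
Proof.
move=> mA mB mf f0; set D := mkset _.
have mD : measurable D by exact: mAG.
rewrite integral_mkcond/= fubini_tonelli1; last 2 first.
- apply/(measurable_restrictT _ mD)/measurable_EFinP; apply: measurable_funTS.
  exact: measurableT_comp.
- by apply: erestrict_ge0 => w _; rewrite lee_fin.
rewrite [RHS]integral_mkcond; apply: eq_integral => x _; rewrite /fubini_F patchE.
case: ifPn => [|]; rewrite ?inE => Ax.
  transitivity (\int[uniform01 R]_(u in [set u | B (G (x, u))]) (f x)%:E).
    rewrite [RHS]integral_mkcond; apply: eq_integral => u _.
    rewrite !patchE; congr (if _ then _ else _).
    by apply/idP/idP; rewrite !inE /D/=; tauto.
  rewrite integral_cst; last exact: (measurable_noise_section GP).
  by rewrite mulrC EFinM (noise_kernelE GP).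
rewrite integral0_eq// => u _; rewrite patchE memNset// => -[] /=.
by move: Ax; rewrite notin_setE.
Qed.

Lemma noise_space_rectangle (A B : set R) : measurable A -> measurable B ->
  P1 [set w | A w.1 /\ B (G w)] = pi (A `*` B).
Proof. exact: GP.2. Qed.

Lemma integral_copies_space
    (f : R * measurableTypeR R * measurableTypeR R -> \bar R) :
  measurable_fun setT f -> (forall w, 0 <= f w) ->
  \int[P2]_w f w = \int[uniform01 R]_v \int[P1]_z f (z, v).
Proof. exact: fubini_tonelli2. Qed.

(* Below, the two product measures only matter through the laws just
   computed. *)
Opaque noise_space copies_space.

Let joint_law_first (A B : set R) : measurable A -> measurable B ->
  P2 [set w | A w.1.1 /\ B (G w.1)] = pi (A `*` B).
Proof.
move=> mA mB.
transitivity (P1 [set w | A w.1 /\ B (G w)]).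
  exact: (P2_fst (mAG mA mB)).
exact: noise_space_rectangle.
Qed.

Let joint_law_second (A C : set R) : measurable A -> measurable C ->
  P2 [set w | A w.1.1 /\ C (G2 w)] = pi (A `*` C).
Proof.
move=> mA mC.
have mD : measurable (fst @^-1` A : set (R * measurableTypeR R)).
  by rewrite -[X in measurable X]setTI; exact: measurable_fst.
rewrite (second_copyE mD mC).
rewrite (integral_image_law (f := EFin \o kG C) _ noise_space_fst)//.
  by rewrite (integral_noise_kernel GP).
by apply/measurable_EFinP; apply: measurable_funTS; exact: (measurable_noise_kernel GP).
Qed.

(** Given [x], the two copies are functions of the independent noises [u] and
    [v], so their conditional law on rectangles is the product of the kernels. *)
Let joint_law_copies (A B C : set R) :
  measurable A -> measurable B -> measurable C ->
  P2 [set w | (A w.1.1 /\ B (G w.1)) /\ C (G2 w)] =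
  \int[mu]_(x in A) (kG B x * kG C x)%:E.
Proof.
move=> mA mB mC; rewrite (second_copyE (mAG mA mB) mC) integral_first_copy//.
  exact: (measurable_noise_kernel GP).
by move=> x; case/andP: (noise_kernel01 GP x mC).
Qed.

Let mfst2 : measurable_fun setT
  (fun w : R * measurableTypeR R * measurableTypeR R => w.1.1).
Proof. exact: measurableT_comp. Qed.

Let mG1 : measurable_fun setT
  (fun w : R * measurableTypeR R * measurableTypeR R => G w.1).
Proof. exact: (measurableT_comp GP.1). Qed.

Definition copy_base : {RV P2 >-> R} := HB.pack
  (fun w : R * measurableTypeR R * measurableTypeR R => w.1.1)
  (isMeasurableFun.Build _ _ _ _ _ mfst2).

Definition first_copy : {RV P2 >-> R} := HB.pack
  (fun w : R * measurableTypeR R * measurableTypeR R => G w.1)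
  (isMeasurableFun.Build _ _ _ _ _ mG1).

Definition second_copy : {RV P2 >-> R} :=
  HB.pack G2 (isMeasurableFun.Build _ _ _ _ _ mG2).

Let copy_base_law (A : set R) : measurable A -> P2 (copy_base @^-1` A) = mu A.
Proof.
move=> mA; transitivity (P1 (fst @^-1` A)); last exact: noise_space_fst.
apply: (P2_fst (D := fst @^-1` A)).
by rewrite -[X in measurable X]setTI; exact: measurable_fst.
Qed.

Let eq_joint_law (W : {RV P2 >-> R}) :
  (forall A B, measurable A -> measurable B ->
    P2 [set w | A (copy_base w) /\ B (W w)] = pi (A `*` B)) ->
  eq_law (joint_law copy_base W) pi.
Proof.
move=> WE; have mbW : measurable_fun setT (fun w => (copy_base w, W w)).
  exact/measurable_fun_prod.
have [m mE] := exists_restricted_image P2 mbW measurableT.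
move=> C mC; transitivity (m C).
  by have := mE C; rewrite setIT => ->.
apply: measure_eq_rectangles => // A B mA mB.
by have := mE (A `*` B); rewrite setIT => ->; exact: WE.
Qed.

Lemma objective_value_copies :
  objective_value pi (\int[P2]_w (`|G w.1 - G (w.1.1, w.2)|%R)%:E).
Proof.
have kernel_version (W : {RV P2 >-> R}) B : measurable B ->
    (forall A, measurable A ->
      P2 [set w | A (copy_base w) /\ B (W w)] = pi (A `*` B)) ->
    cond_prob_version copy_base (W @^-1` B) (kG B).
  move=> mB WE; split; first exact: (measurable_noise_kernel GP).
  move=> A mA; rewrite (integral_image_law (f := EFin \o kG B) _ copy_base_law)//.
    by rewrite (integral_noise_kernel GP)// -WE.
  by apply/measurable_EFinP; apply: measurable_funTS;
    exact: (measurable_noise_kernel GP).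
exists _, _, P2, copy_base, first_copy, second_copy; split.
- by apply: eq_joint_law => A B mA mB; exact: joint_law_first.
- by apply: eq_joint_law => A B mA mB; exact: joint_law_second.
- move=> B C mB mC; exists (kG B), (kG C); split.
  + by apply: kernel_version => // A mA; exact: joint_law_first.
  + by apply: kernel_version => // A mA; exact: joint_law_second.
  have mk : measurable_fun setT (fun x => kG B x * kG C x)%R.
    by apply: measurable_funM; exact: (measurable_noise_kernel GP).
  split=> // A mA; rewrite (integral_image_law
    (f := fun x => (kG B x * kG C x)%:E) _ copy_base_law)//; last first.
    by apply/measurable_EFinP; exact: measurable_funTS.
  transitivity (P2 [set w | (A w.1.1 /\ B (G w.1)) /\ C (G2 w)]).
    exact/esym/joint_law_copies.
  by congr (P2 _); apply/seteqP; split => w /=; tauto.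
by rewrite unlock.
Qed.

Lemma objectiveE :
  objective pi = \int[P2]_w (`|G w.1 - G (w.1.1, w.2)|%R)%:E.
Proof.
rewrite /objective; case: xgetP => [j _ jP|/(_ _ objective_value_copies)//].
exact: objective_value_unique jP objective_value_copies.
Qed.

Lemma copies_rectangle (B C : set R) : measurable B -> measurable C ->
  P2 [set w | B (G w.1) /\ C (G (w.1.1, w.2))] =
  \int[mu]_x (kG B x * kG C x)%:E.
Proof.
move=> mB mC.
transitivity (P2 [set w | ([set: R] w.1.1 /\ B (G w.1)) /\ C (G2 w)]).
  by congr (P2 _); apply/seteqP; split => w /=; tauto.
exact: joint_law_copies.
Qed.

Lemma first_copy_law (B : set R) : measurable B ->
  P2 ((fun w => G w.1) @^-1` B) = pi (setT `*` B).
Proof.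
move=> mB; transitivity (P2 [set w | [set: R] w.1.1 /\ B (G w.1)]).
  by congr (P2 _); apply/seteqP; split => w /=; tauto.
exact: joint_law_first.
Qed.

Lemma second_copy_law (B : set R) : measurable B ->
  P2 ((fun w => G (w.1.1, w.2)) @^-1` B) = pi (setT `*` B).
Proof.
move=> mB; transitivity (P2 [set w | [set: R] w.1.1 /\ B (G2 w)]).
  by congr (P2 _); apply/seteqP; split => w /=; tauto.
exact: joint_law_second.
Qed.

Lemma measurable_first_copy : measurable_fun setT
  (fun w : R * measurableTypeR R * measurableTypeR R => G w.1).
Proof. exact: mG1. Qed.

Lemma measurable_second_copy : measurable_fun setT
  (fun w : R * measurableTypeR R * measurableTypeR R => G (w.1.1, w.2)).
Proof. exact: mG2. Qed.

End cond_indep_law.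

(** * Layer-cake formula for the objective *)

Section layer_cake.
Context d (Omega : measurableType d) (R : realType) (P : probability Omega R).
Variables Y Z : Omega -> R.
Hypotheses (mY : measurable_fun setT Y) (mZ : measurable_fun setT Z).
Local Notation leb := (@lebesgue_measure R).

Let between : set (Omega * measurableTypeR R)%type :=
  [set w | (Y w.1 <= w.2 < Z w.1)%R].

Let measurable_between : measurable between.
Proof.
have mb : measurable_fun setT
    (fun w : Omega * measurableTypeR R => (Y w.1 <= w.2 < Z w.1)%R).
  apply: measurable_and; [apply: measurable_fun_ler|apply: measurable_fun_ltr] => //;
  exact: measurableT_comp.
by rewrite -[between]setTI; exact: (mb measurableT [set true]).
Qed.

Lemma measurable_prob_between : measurable_fun setT
  (fun t : measurableTypeR R => P [set w | (Y w <= t < Z w)%R]).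
Proof.
rewrite (_ : (fun t => _) = P \o ysection between).
  exact: measurable_fun_ysection.
by apply/funext => t /=; congr (P _); apply/seteqP; split => w;
  rewrite /ysection /= inE.
Qed.

Lemma measurable_length_between : measurable_fun setT
  (fun w => leb [set t | (Y w <= t < Z w)%R]).
Proof.
rewrite (_ : (fun w => _) = leb \o xsection between).
  exact: measurable_fun_xsection.
by apply/funext => w /=; congr (leb _); apply/seteqP; split => t;
  rewrite /xsection /= inE.
Qed.

(** Both sides are the product measure of the region between the graphs of [Y]
    and [Z], computed by vertical and by horizontal sections. *)
Lemma integral_prob_between :
  \int[P]_w leb [set t | (Y w <= t < Z w)%R] =
  \int[leb]_t P [set w | (Y w <= t < Z w)%R].
Proof.
transitivity (\int[P]_w (fubini_F leb (EFin \o \1_between) w)).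
  apply: eq_integral => w _; rewrite indic_fubini_tonelli_FE//=.
  by congr (leb _); apply/seteqP; split => t; rewrite /xsection /= inE.
rewrite indic_fubini_tonelli//; apply: eq_integral => t _.
rewrite indic_fubini_tonelli_GE//=.
by congr (P _); apply/seteqP; split => w; rewrite /ysection /= inE.
Qed.

End layer_cake.

Lemma expectation_dist_layers d (Omega : measurableType d) (R : realType)
    (P : probability Omega R) (Y Z : Omega -> R) :
  measurable_fun setT Y -> measurable_fun setT Z ->
  \int[P]_w (`|Y w - Z w|%R)%:E =
  \int[@lebesgue_measure R]_t
    (P [set w | (Y w <= t < Z w)%R] + P [set w | (Z w <= t < Y w)%R]).
Proof.
move=> mY mZ; rewrite [RHS]ge0_integralD//; [|exact: measurable_prob_between..].
rewrite -!integral_prob_between//.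
rewrite -ge0_integralD//; [|exact: measurable_length_between..].
apply: eq_integral => w _.
have length (y z : R) : lebesgue_measure [set t | (y <= t < z)%R] =
    if (y < z)%R then (z - y)%:E else 0.
  rewrite (_ : mkset _ = `[y, z[%classic); last first.
    by apply/seteqP; split => t; rewrite /= in_itv.
  by rewrite lebesgue_measure_itv/= lte_fin.
rewrite !length; have [YZ|ZY|->] := ltgtP (Y w) (Z w).
- by rewrite adde0 distrC gtr0_norm// subr_gt0.
- by rewrite add0e gtr0_norm// subr_gt0.
- by rewrite subrr normr0 adde0.
Qed.

(** The mean conditional variance, given [X], of the indicator of [Y <= t]. *)
Definition spread d (X : measurableType d) (R : realType) (mu : probability X R)
    (G : X * measurableTypeR R -> R) (t : R) : \bar R :=
  \int[mu]_x (noise_kernel G `]-oo, t]%classic x *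
    (1 - noise_kernel G `]-oo, t]%classic x))%:E.

Section spread.
Context (R : realType).
Variables (mu : probability R R) (pi : probability (R * R)%type R).
Variable G : R * measurableTypeR R -> R.
Hypothesis GP : noise_represents mu pi G.
Local Notation leb := (@lebesgue_measure R).
Local Notation kG t := (noise_kernel G `]-oo, t]%classic).
Local Notation P2 := (copies_space mu).

Let mk t : measurable_fun setT (kG t).
Proof. exact: (measurable_noise_kernel GP). Qed.

Let k01 t x : (0 <= kG t x <= 1)%R.
Proof. exact: (noise_kernel01 GP). Qed.

Lemma spread_ge0 t : 0 <= spread mu G t.
Proof.
apply: integral_ge0 => x _; case/andP: (k01 t x) => k0 k1.
by rewrite lee_fin mulr_ge0// subr_ge0.
Qed.

(** The complement of a half-line has kernel [1 - k_t], and the two copies play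
    symmetric roles, hence the two equal probabilities. *)
Lemma spreadE t :
  P2 [set w | (G w.1 <= t < G (w.1.1, w.2))%R] = spread mu G t /\
  P2 [set w | (G (w.1.1, w.2) <= t < G w.1)%R] = spread mu G t.
Proof.
have kC x : noise_kernel G (~` `]-oo, t]%classic) x = (1 - kG t x)%R.
  exact: (noise_kernelC GP).
have mI : measurable (`]-oo, t]%classic : set R) by exact: measurable_itv.
have mC : measurable (~` `]-oo, t]%classic : set R) by exact: measurableC.
split.
- transitivity (P2 [set w | `]-oo, t]%classic (G w.1) /\
      (~` `]-oo, t]%classic) (G (w.1.1, w.2))]).
    congr (P2 _); apply/seteqP; split => w /=; rewrite !in_itv/= ltNge.
      by move=> /andP[? /negP].
    by move=> [-> /negP].
  rewrite (copies_rectangle GP mI mC); apply: eq_integral => x _.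
  by rewrite kC.
- transitivity (P2 [set w | (~` `]-oo, t]%classic) (G w.1) /\
      `]-oo, t]%classic (G (w.1.1, w.2))]).
    congr (P2 _); apply/seteqP; split => w /=; rewrite !in_itv/= ltNge.
      by move=> /andP[? /negP].
    by move=> [/negP ? ->].
  rewrite (copies_rectangle GP mC mI); apply: eq_integral => x _.
  by rewrite kC mulrC.
Qed.

Lemma measurable_spread :
  measurable_fun setT (spread mu G : measurableTypeR R -> \bar R).
Proof.
rewrite (_ : spread mu G = fun t => P2 [set w | (G w.1 <= t < G (w.1.1, w.2))%R]).
  apply: measurable_prob_between; first exact: (measurable_first_copy GP).
  exact: (measurable_second_copy GP).
by apply/funext => t; have [-> _] := spreadE t.
Qed.

Lemma objective_spread :
  objective pi = \int[leb]_t spread mu G t + \int[leb]_t spread mu G t.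
Proof.
rewrite (objectiveE GP) -ge0_integralD//; last 4 first.
- by move=> t _; exact: spread_ge0.
- exact: measurable_spread.
- by move=> t _; exact: spread_ge0.
- exact: measurable_spread.
rewrite expectation_dist_layers; last 2 first.
- exact: (measurable_first_copy GP).
- exact: (measurable_second_copy GP).
by apply: eq_integral => t _; have [-> ->] := spreadE t.
Qed.

End spread.

(** * Total variance decomposition *)

Lemma coupling_fst (R : realType) (mu nu : probability R R)
    (pi : probability (R * R)%type R) (A : set R) :
  coupling mu nu pi -> measurable A -> pi (A `*` setT) = mu A.
Proof.
move=> [mu_pi _] mA; rewrite -mu_pi// /pushforward; congr (pi _).
by apply/seteqP; split => -[x y] //= [].
Qed.

Lemma coupling_snd (R : realType) (mu nu : probability R R)
    (pi : probability (R * R)%type R) (B : set R) :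
  coupling mu nu pi -> measurable B -> pi (setT `*` B) = nu B.
Proof.
move=> [_ nu_pi] mB; rewrite -nu_pi// /pushforward; congr (pi _).
by apply/seteqP; split => -[x y] //= [].
Qed.

Lemma product_coupling (R : realType) (mu nu : probability R R) :
  coupling mu nu (mu \x nu).
Proof.
split; first by move=> A mA; exact: product_probability_fst.
move=> B mB; rewrite /pushforward (_ : snd @^-1` B = setT `*` B).
  transitivity (mu setT * nu B); first exact: product_measure1E.
  by rewrite probability_setT mul1e.
by apply/seteqP; split => -[x y] //= [].
Qed.

Lemma coupling_noise_representation (R : realType) (mu nu : probability R R)
    (pi : probability (R * R)%type R) :
  coupling mu nu pi -> exists G, noise_represents mu pi G.
Proof.
move=> cpi; apply: exists_noise_representation => A mA.
exact: coupling_fst cpi mA.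
Qed.

(** The variance of the conditional probability of [Y <= t] given [X]: together
    with [spread], the two terms of the law of total variance. *)
Definition deviation (R : realType) (mu nu : probability R R)
    (G : R * measurableTypeR R -> R) (t : R) : \bar R :=
  \int[mu]_x ((noise_kernel G `]-oo, t]%classic x -
    fine (nu `]-oo, t]%classic)) ^+ 2)%:E.

Section coupling_spread.
Context (R : realType).
Variables (mu nu : probability R R) (pi : probability (R * R)%type R).
Variable G : R * measurableTypeR R -> R.
Hypothesis GP : noise_represents mu pi G.
Hypothesis cpi : coupling mu nu pi.
Local Notation kG t := (noise_kernel G `]-oo, t]%classic).
Local Notation F t := (fine (nu `]-oo, t]%classic)).

Let mk t : measurable_fun setT (kG t).
Proof. exact: (measurable_noise_kernel GP). Qed.

Let k01 t x : (0 <= kG t x <= 1)%R.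
Proof. exact: (noise_kernel01 GP). Qed.

Let FE t : (F t)%:E = nu `]-oo, t]%classic.
Proof. by rewrite fineK// fin_num_measure//; exact: measurable_itv. Qed.

Let integral_kernel t : \int[mu]_x (kG t x)%:E = (F t)%:E.
Proof.
rewrite (integral_noise_kernel GP)// FE; exact: coupling_snd cpi _.
Qed.

(** The mean of [k_t] is [F t], and
    [k (1 - k) + (k - F)^2 = (1 - 2 F) k + F^2]. *)
Lemma spread_deviation t :
  spread mu G t + deviation mu nu G t = (F t * (1 - F t))%:E.
Proof.
have msq : measurable_fun setT (fun x => (kG t x - F t) ^+ 2)%R.
  by apply: measurable_funX; exact: measurable_funB.
have mvar : measurable_fun setT (fun x => kG t x * (1 - kG t x))%R.
  by apply: measurable_funM => //; exact: measurable_funB.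
rewrite /spread /deviation -ge0_integralD//; last 4 first.
- move=> x _; case/andP: (k01 t x) => k0 k1.
  by rewrite lee_fin mulr_ge0// subr_ge0.
- exact/measurable_EFinP.
- by move=> x _; rewrite lee_fin sqr_ge0.
- exact/measurable_EFinP.
have ik := integrable_noise_kernel GP (measurable_itv `]-oo, t]).
rewrite (eq_integral (fun x => (1 - F t *+ 2)%:E * (kG t x)%:E + (F t ^+ 2)%:E)).
  rewrite integralD//; last 2 first.
  - by apply: integrableZl ik.
  - exact: (finite_measure_integrable_cst mu (F t ^+ 2)%R).
  rewrite integralZl// integral_kernel.
  have -> : \int[mu]_x (F t ^+ 2)%:E = (F t ^+ 2)%:E.
    rewrite integral_cst// -[RHS]mule1; congr (_ * _).
    exact: probability_setT.
  by rewrite -EFinM -EFinD; congr EFin; ring.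
by move=> x _; rewrite -EFinM -!EFinD; congr EFin; ring.
Qed.

Lemma deviation_ge0 t : 0 <= deviation mu nu G t.
Proof. by apply: integral_ge0 => x _; rewrite lee_fin sqr_ge0. Qed.

Lemma deviationE t :
  deviation mu nu G t = (F t * (1 - F t))%:E - spread mu G t.
Proof.
rewrite -spread_deviation addeAC subee ?add0e//.
rewrite ge0_fin_numE ?(spread_ge0 GP)//.
apply: (@le_lt_trans _ _ (F t * (1 - F t))%:E); last by rewrite ltry.
by rewrite -spread_deviation leeDl// deviation_ge0.
Qed.

Lemma measurable_deviation : measurable_fun setT
  (deviation mu nu G : measurableTypeR R -> \bar R).
Proof.
have mF : measurable_fun setT ((fun t => F t) : measurableTypeR R -> R).
  apply: nondecreasing_measurable => //= s t st.
  rewrite fine_le ?fin_num_measure//; [exact: measurable_itv..|].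
  by apply: le_measure; rewrite ?inE//; apply: subset_itvl; rewrite bnd_simp.
rewrite (_ : deviation mu nu G = fun t => (F t * (1 - F t))%:E - spread mu G t).
  apply: emeasurable_funB; last exact: (measurable_spread GP).
  by apply/measurable_EFinP; apply: measurable_funM => //; exact: measurable_funB.
by apply/funext => t; exact: deviationE.
Qed.

Lemma deviation_eq0 t : deviation mu nu G t = 0 ->
  forall A, measurable A ->
    pi (A `*` `]-oo, t]%classic) = mu A * nu `]-oo, t]%classic.
Proof.
move=> dev0 A mA.
have msq : measurable_fun setT (fun x => ((kG t x - F t) ^+ 2)%:E).
  by apply/measurable_EFinP; apply: measurable_funX; exact: measurable_funB.
have : ae_eq mu setT (fun x => ((kG t x - F t) ^+ 2)%:E) (cst 0).
  apply/ae_eq_integral_abs => //; rewrite -[RHS]dev0.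
  by apply: eq_integral => x _; rewrite gee0_abs// lee_fin sqr_ge0.
move=> kF; rewrite -(integral_noise_kernel GP)//.
rewrite (ae_eq_integral (cst (F t)%:E))//.
- by rewrite integral_cst// FE muleC.
- by apply/measurable_EFinP; exact: measurable_funS (mk t).
apply: filterS kF => x h _; have [] := h I.
by move=> /eqP; rewrite sqrf_eq0 subr_eq0 => /eqP ->.
Qed.

End coupling_spread.

(** Under the product coupling the constant [nu ]-oo, t]] is a version of the
    conditional probability of [Y <= t]. *)
Lemma deviation_product (R : realType) (mu nu : probability R R)
    (G : R * measurableTypeR R -> R) (t : R) :
  noise_represents mu (mu \x nu) G -> deviation mu nu G t = 0.
Proof.
move=> GP; have mI : measurable (`]-oo, t]%classic : set R) by exact: measurable_itv.
have kF := @noise_kernel_unique _ _ _ _ _ _ GP _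
  (cst (fine (nu `]-oo, t]%classic))) mI (measurable_cst _).
rewrite /deviation (ae_eq_integral (cst 0)) ?integral0//.
- apply/measurable_EFinP; apply: measurable_funX; apply: measurable_funB => //.
  exact: (measurable_noise_kernel GP).
apply: filterS (kF _) => [x -> _|A mA]; first by rewrite subrr expr0n.
transitivity ((fine (nu `]-oo, t]%classic))%:E * mu A).
  by rewrite -integral_cst.
rewrite fineK ?fin_num_measure// muleC.
by apply/esym; exact: product_measure1E.
Qed.

(** * Maximizers *)

Section maximizers.
Context (R : realType) (mu nu : probability R R).
Local Notation leb := (@lebesgue_measure R).

Lemma objective_fin_num (pi : probability (R * R)%type R) :
  \int[nu]_y `|y|%:E < +oo -> coupling mu nu pi -> objective pi \is a fin_num.
Proof.
move=> nu_moment cpi; have [G GP] := coupling_noise_representation cpi.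
have mG1 := measurable_first_copy GP; have mG2 := measurable_second_copy GP.
have mnorm : measurable_fun setT (fun y : R => `|y|%:E).
  by apply/measurable_EFinP; exact: normr_measurable.
have law1 B : measurable B ->
    copies_space mu ((fun w => G w.1) @^-1` B) = nu B.
  by move=> mB; rewrite (first_copy_law GP mB); exact: coupling_snd cpi mB.
have law2 B : measurable B ->
    copies_space mu ((fun w => G (w.1.1, w.2)) @^-1` B) = nu B.
  by move=> mB; rewrite (second_copy_law GP mB); exact: coupling_snd cpi mB.
rewrite (objectiveE GP) ge0_fin_numE; last first.
  by apply: integral_ge0 => w _; rewrite lee_fin.
apply: (@le_lt_trans _ _ (\int[copies_space mu]_w
    (`|G w.1|%:E + `|G (w.1.1, w.2)|%:E))).
  apply: ge0_le_integral => //.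
  - apply/measurable_EFinP; apply: measurableT_comp => //.
    exact: measurable_funB.
  - by apply: emeasurable_funD; apply: measurableT_comp mnorm _.
  - by move=> w _; rewrite -EFinD lee_fin; exact: ler_normB.
rewrite ge0_integralD//; last 2 first.
- exact: measurableT_comp mnorm _.
- exact: measurableT_comp mnorm _.
have e1 := integral_image_law mG1 law1 measurableT mnorm.
have e2 := integral_image_law mG2 law2 measurableT mnorm.
rewrite !preimage_setT in e1 e2; rewrite [X in X + _]e1 [X in _ + X]e2.
exact: lte_add_pinfty.
Qed.

(** The product coupling has zero deviation, so its spread at [t] is
    [F t * (1 - F t)], the sum of spread and deviation of any other coupling. *)
Lemma objective_deviation (pi : probability (R * R)%type R)
    (G : R * measurableTypeR R -> R) :
  noise_represents mu pi G -> coupling mu nu pi ->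
  objective (mu \x nu) = objective pi +
    (\int[leb]_t deviation mu nu G t + \int[leb]_t deviation mu nu G t).
Proof.
move=> GP cpi; have cind := product_coupling mu nu.
have [G0 GP0] := coupling_noise_representation cind.
have spread_split t : spread mu G0 t = spread mu G t + deviation mu nu G t.
  rewrite (spread_deviation GP cpi) -(spread_deviation GP0 cind).
  by rewrite deviation_product// adde0.
have double (a b c x y : \bar R) :
    x = a + a -> y = b + b -> a = b + c -> x = y + (c + c).
  by move=> -> -> ->; rewrite addeACA.
apply: double (objective_spread GP0) (objective_spread GP) _.
rewrite -ge0_integralD//; first by apply: eq_integral => t _.
- by move=> t _; exact: (spread_ge0 GP).
- exact: (measurable_spread GP).
- by move=> t _; exact: deviation_ge0.
- exact: (measurable_deviation GP cpi).
Qed.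

Lemma objective_le_product (pi : probability (R * R)%type R) :
  coupling mu nu pi -> objective pi <= objective (mu \x nu).
Proof.
move=> cpi; have [G GP] := coupling_noise_representation cpi.
rewrite (objective_deviation GP cpi) leeDl// adde_ge0// integral_ge0// => t _;
exact: deviation_ge0.
Qed.

(** The deviation vanishes for almost every [t], in particular for some [t] in
    each open interval, which is enough to compare half-lines up to a gap. *)
Lemma eq_product_of_objective (pi : probability (R * R)%type R) :
  \int[nu]_y `|y|%:E < +oo -> coupling mu nu pi ->
  objective pi = objective (mu \x nu) -> eq_law pi (mu \x nu).
Proof.
move=> nu_moment cpi; have [G GP] := coupling_noise_representation cpi.
set D := \int[leb]_t deviation mu nu G t => obj.
have D_ge0 : 0 <= D by apply: integral_ge0 => t _; exact: deviation_ge0.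
have D0 : D = 0.
  have ofin := objective_fin_num nu_moment cpi.
  have cancel (x z : \bar R) : x \is a fin_num -> z = 0 \/ x <> x + z.
    move: x z => [r| |] [z| |]//= _; [|by right|by right].
    have [->|z0] := eqVneq z 0%R; first by left.
    by right => -[rz]; move/eqP: z0; apply; lra.
  have DD0 : D + D = 0.
    have [//|[]] := cancel _ (D + D) ofin; rewrite [LHS]obj.
    exact: objective_deviation.
  by move: DD0 => /eqP; rewrite padde_eq0// => /andP[/eqP].
have [N [mN N0 devN]] : ae_eq leb setT (deviation mu nu G) (cst 0).
  apply/ae_eq_integral_abs => //; first exact: (measurable_deviation GP cpi).
  rewrite -[RHS]D0; apply: eq_integral => t _.
  by rewrite gee0_abs// deviation_ge0.
have dense (s y : R) : (s < y)%R -> exists2 t : R, (s < t < y)%R &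
    forall A, measurable A ->
      pi (A `*` `]-oo, t]%classic) = mu A * nu `]-oo, t]%classic.
  move=> sy; apply: contrapT => h.
  have : leb `]s, y[%classic <= leb N.
    apply: le_measure; rewrite ?inE//.
    move=> t; rewrite /= in_itv/= => sty; apply: contrapT => Nt; apply: h.
    exists t => //; apply: (deviation_eq0 (nu := nu) GP).
    by apply: contrapT => dev; apply: Nt; apply: devN => /= /(_ I).
  by rewrite N0 lebesgue_measure_itv/= lte_fin sy -EFinD lee_fin subr_le0 leNgt sy.
pose ind : probability (R * R)%type R := mu \x nu.
(* Fix the first side of a rectangle and compare the two finite measures in
   the second one on half-lines. *)
suff rect A B : measurable A -> measurable B -> pi (A `*` B) = ind (A `*` B).
  exact: (measure_eq_rectangles (m1 := pi) (m2 := ind) rect).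
move=> mA mB.
have mA2 : measurable (A `*` [set: R]) by exact: measurableX.
have [m1 m1E] := exists_restricted_image pi measurable_snd mA2.
have [m2 m2E] := exists_restricted_image ind measurable_snd mA2.
have m1R C : m1 C = pi (A `*` C).
  by rewrite m1E; congr (pi _); apply/seteqP; split => -[x z] /=; tauto.
have m2R C : measurable C -> m2 C = mu A * nu C.
  move=> mC; rewrite m2E; transitivity ((mu \x nu) (A `*` C)).
    by congr (product_measure1 _ _ _); apply/seteqP; split => -[x z] /=; tauto.
  exact: product_measure1E.
transitivity (m1 B); first by rewrite m1R.
transitivity (m2 B); last first.
  by rewrite m2R//; apply/esym; exact: product_measure1E.
have m12 t : (forall A, measurable A ->
      pi (A `*` `]-oo, t]%classic) = mu A * nu `]-oo, t]%classic) ->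
    m1 `]-oo, t]%classic = m2 `]-oo, t]%classic.
  by move=> pit; rewrite m1R m2R// pit.
have ray (m : {finite_measure set R -> \bar R}) (s t : R) : (s < t)%R ->
    (m `]-oo, s]%classic <= m `]-oo, t]%classic) *
    (m `]-oo, s]%classic <= m `]-oo, t[%classic).
  move=> st; split; apply: le_measure; rewrite ?inE//; apply: subset_itvl;
  by rewrite bnd_simp// ltW.
apply: measure_eq_rays => // s y /dense[t /andP[st ty] /m12 e].
- by rewrite (le_trans (ray _ _ _ st).1)// e (ray _ _ _ ty).2.
- by rewrite (le_trans (ray _ _ _ st).1)// -e (ray _ _ _ ty).2.
Qed.

End maximizers.

(** * Minimizers *)

Lemma measure_eq_off_null d (T : measurableType d) (R : realType)
    (m : {measure set T -> \bar R}) (A B : set T) :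
  measurable A -> measurable B -> {ae m, forall x, A x <-> B x} -> m A = m B.
Proof.
have le (C D : set T) : measurable C -> measurable D ->
    {ae m, forall x, C x <-> D x} -> m C <= m D.
  move=> mC mD [N [mN N0 CDN]]; rewrite -[leRHS]adde0 -N0.
  apply: le_trans (measureU2 _ mD mN); apply: le_measure; rewrite ?inE//.
    exact: measurableU.
  move=> x Cx; have [Nx|Nx] := pselect (N x); [by right|left].
  by apply: contrapT => Dx; apply: Nx; apply: CDN => /= -[/(_ Cx)].
move=> mA mB AB; apply/eqP; rewrite eq_le !le//.
by apply: filterS AB => x; tauto.
Qed.

Section minimizers.
Context (R : realType) (mu nu : probability R R).

Lemma monge_coupling (T : R -> R) (pi : probability (R * R)%type R) :
  monge_map mu nu T -> eq_law (map_law mu T) pi -> coupling mu nu pi.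
Proof.
move=> [mT Tnu] Tpi; split=> A mA; rewrite /pushforward.
- rewrite -Tpi// -[X in measurable X]setTI; exact: measurable_fst.
- rewrite -Tnu// -Tpi// -[X in measurable X]setTI; exact: measurable_snd.
Qed.

Lemma exists_map_law (T : R -> R) : measurable_fun setT T ->
  exists pi : probability (R * R)%type R, eq_law (map_law mu T) pi.
Proof.
move=> mT; have mf : measurable_fun setT (fun x : R => (x, T x)).
  exact/measurable_fun_prod.
pose f : {mfun R >-> (R * R)%type} :=
  HB.pack (fun x : R => (x, T x)) (isMeasurableFun.Build _ _ _ _ _ mf).
by exists (distribution mu f).
Qed.

(** The triple [(id, T, T)] on the real line with measure [mu] realizes [pi], and
    its second and third components are trivially conditionally independent
    given the first, being functions of it. *)
Lemma objective_map_law (T : R -> R) (pi : probability (R * R)%type R) :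
  monge_map mu nu T -> eq_law (map_law mu T) pi -> objective pi = 0.
Proof.
move=> TP Tpi; have [mT _] := TP.
have [G GP] := coupling_noise_representation (monge_coupling TP Tpi).
pose X : {RV mu >-> R} := HB.pack (fun x : R => x)
  (isMeasurableFun.Build _ _ _ _ _ (@measurable_id _ R setT)).
pose Y : {RV mu >-> R} := HB.pack T (isMeasurableFun.Build _ _ _ _ _ mT).
have mTset B : measurable B -> measurable (T @^-1` B).
  by move=> mB; rewrite -[X in measurable X]setTI; exact: (mT measurableT).
have version (E : set R) : measurable E -> cond_prob_version X E \1_E.
  move=> mE; split; first exact: measurable_indic.
  by move=> A mA; rewrite integral_indic// setIC.
have val0 : objective_value pi 0.
  exists _, R, mu, X, Y, Y; split => //.
  - move=> B C mB mC; exists \1_(T @^-1` B), \1_(T @^-1` C); split.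
    + by apply: version; exact: mTset.
    + by apply: version; exact: mTset.
    + rewrite (_ : (fun x => _) = \1_(T @^-1` B `&` T @^-1` C)).
        by apply: version; apply: measurableI; exact: mTset.
      by rewrite indicI.
  - rewrite unlock integral0_eq// => x _.
    by rewrite subrr normr0.
rewrite /objective; case: xgetP => [j _ jP|/(_ _ val0)//].
exact: (objective_value_unique GP jP val0).
Qed.

Lemma objective_ge0 (pi : probability (R * R)%type R) :
  coupling mu nu pi -> 0 <= objective pi.
Proof.
move=> cpi; have [G GP] := coupling_noise_representation cpi.
by rewrite (objectiveE GP); apply: integral_ge0 => w _; rewrite lee_fin.
Qed.

(** By Fubini, for almost every value [v] of the second noise,
    [G (x, u) = G (x, v)] for almost every [(x, u)]. For one such [v] the map
    [T x = G (x, v)] reproduces the law of [(X, G (X, U))], which is [pi]. *)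
Lemma monge_of_objective_eq0 (pi : probability (R * R)%type R) :
  coupling mu nu pi -> objective pi = 0 ->
  exists2 T, monge_map mu nu T & eq_law (map_law mu T) pi.
Proof.
move=> cpi; have [G GP] := coupling_noise_representation cpi.
have mG := measurable_first_copy GP; have mG' := measurable_second_copy GP.
have mGv v : measurable_fun setT (fun x => G (x, v)).
  exact: (measurableT_comp GP.1 (measurable_pair2 v)).
have mdist : measurable_fun setT
    (fun w : R * measurableTypeR R * measurableTypeR R =>
      (`|G w.1 - G (w.1.1, w.2)|%R)%:E).
  by apply/measurable_EFinP; apply: measurableT_comp => //; exact: measurable_funB.
rewrite (objectiveE GP) integral_copies_space//=.
set f := fun v => \int[noise_space mu]_z _ => f0.
have mf : measurable_fun setT f.
  apply: (measurable_fun_fubini_tonelli_G (m1 := noise_space mu) _ mdist) => w.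
  by rewrite lee_fin.
have : ae_eq (uniform01 R) setT f (cst 0).
  apply/ae_eq_integral_abs => //; rewrite -[RHS]f0.
  by apply: eq_integral => v _; rewrite gee0_abs// integral_ge0.
move=> [N [mN N0 fN]].
have [v Nv] : exists v, ~ N v.
  apply: contrapT => h; suff NT : N = setT.
    move: N0; rewrite NT [LHS](probability_setT (uniform01 R)) => /eqP.
    by rewrite onee_eq0.
  rewrite -subTset => v _; apply: contrapT => Nv; apply: h; by exists v.
have fv0 : f v = 0 by apply: contrapT => h; apply: Nv; apply: fN => /= /(_ I).
have mTz : measurable_fun setT (fun z : R * measurableTypeR R => G (z.1, v)).
  exact: (measurableT_comp (mGv v)).
have GT : {ae noise_space mu, forall z, G z = G (z.1, v)}.
  have h : ae_eq (noise_space mu) setT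
      (fun z => (`|G z - G (z.1, v)|%R)%:E) (cst 0).
    apply/ae_eq_integral_abs => //.
      apply/measurable_EFinP; apply: measurableT_comp => //.
      by apply: measurable_funB => //; exact: GP.1.
    rewrite -[RHS]fv0; apply: eq_integral => z _.
    by rewrite gee0_abs// lee_fin.
  apply: filterS h => z /(_ I) [] /eqP; rewrite normr_eq0 subr_eq0.
  by move/eqP.
pose T x := G (x, v); have mT : measurable_fun setT T := mGv v.
have mTset B : measurable B -> measurable (T @^-1` B).
  by move=> mB; rewrite -[X in measurable X]setTI; exact: (mT measurableT).
have rect A B : measurable A -> measurable B ->
    mu (A `&` T @^-1` B) = pi (A `*` B).
  move=> mA mB.
  transitivity (noise_space mu (fst @^-1` (A `&` T @^-1` B))).
    by apply/esym/noise_space_fst; apply: measurableI => //; exact: mTset.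
  transitivity (noise_space mu [set z | A z.1 /\ B (G z)]); last first.
    exact: (noise_space_rectangle GP).
  have mfst C : measurable C -> measurable
      (fst @^-1` C : set (R * measurableTypeR R)).
    by move=> mC; rewrite -[X in measurable X]setTI; exact: measurable_fst.
  apply: (measure_eq_off_null (m := noise_space mu)).
  - by apply: mfst; apply: measurableI => //; exact: mTset.
  - apply: measurableI; first exact: mfst.
    by rewrite -[X in measurable X]setTI; exact: GP.1.
  - by apply: filterS GT => z Gz; rewrite /= Gz.
have law : eq_law (map_law mu T) pi.
  have mf2 : measurable_fun setT (fun x : R => (x, T x)).
    exact/measurable_fun_prod.
  have [m mE] := exists_restricted_image mu mf2 measurableT.
  move=> C mC; transitivity (m C); first by rewrite mE setIT.
  apply: measure_eq_rectangles => // A B mA mB.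
  have := mE (A `*` B); rewrite setIT => ->; exact: rect.
exists T => //; split => // B mB.
transitivity (pi (setT `*` B)); last exact: coupling_snd cpi mB.
by have := rect setT B measurableT mB; rewrite setTI.
Qed.

End minimizers.

Theorem proposition19 (R : realType) (mu nu : probability R R)
    (nu_moment : \int[nu]_y `|y|%:E < +oo) :
  [/\ maximizer mu nu (mu \x nu),
      (forall pi : probability (R * R)%type R,
         maximizer mu nu pi -> eq_law pi (mu \x nu)) &
      (monge_map mu nu !=set0 ->
       minimizer mu nu =
         [set pi : probability (R * R)%type R |
           exists2 T, monge_map mu nu T & eq_law (map_law mu T) pi])].
Proof.
split.
- split; first exact: product_coupling.
  by move=> pi'; exact: objective_le_product.
- move=> pi [cpi pi_max]; apply: eq_product_of_objective => //.
  apply/eqP; rewrite eq_le; apply/andP; split; first exact: objective_le_product.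
  by apply: pi_max; exact: product_coupling.
move=> [T TP]; apply/seteqP; split => pi.
- move=> [cpi pi_min]; apply: monge_of_objective_eq0 => //.
  have [pi0 Tpi0] := exists_map_law mu TP.1.
  apply/eqP; rewrite eq_le; apply/andP; split; last exact: objective_ge0 cpi.
  rewrite -(objective_map_law TP Tpi0).
  by apply: pi_min; exact: monge_coupling Tpi0.
- move=> [T' T'P T'pi]; split; first exact: monge_coupling T'pi.
  move=> pi' cpi'; rewrite (objective_map_law T'P T'pi).
  exact: objective_ge0 cpi'.
Qed.
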